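(* Let $l\in\mathbb{Z}_{>0}$ and let $X=(X_1,\ldots,X_l)$ be an $l$-symbol with multicharge $(m_1,\ldots,m_l)$. If $m_1=\cdots=m_l$, then the injective map $f:\mathcal{H}^{CJ}(X)\to\mathcal{H}^{BGO}(X)$ described in the context is a bijection.
   Context: $\mathbb{N}=\mathbb{Z}_{\ge 0}$. A $\beta$-set of charge $m$ is a finite strictly increasing sequence $(a_1,\ldots,a_m)$ of elements of $\mathbb{N}$, identified with the set of its entries. An $l$-symbol is an $l$-tuple $X=(X_1,\ldots,X_l)$ of $\beta$-sets; its multicharge is $(m_1,\ldots,m_l)$, where $m_j$ is the charge of $X_j$. Set $\Gamma_j=\mathbb{N}\setminus X_j$ for $1\le j\le l$. A hook in $X$ is a quadruple $(a,b,i,j)$ with $a,b\in\mathbb{N}$, $1\le i,j\le l$, $a\in X_i$ and $b\in\Gamma_j$. A BGO-hook in $X$ is a hook $(a,b,i,j)$ such that $a\ge b$ and, if $a=b$, then $i>j$. A CJ-hook in $X$ is a hook $(a,b,i,j)$ such that $\sharp\{\gamma\in\Gamma_i\mid a>\gamma\}>\sharp\{\gamma\in\Gamma_j\mid b>\gamma\}$. The sets of BGO-hooks and CJ-hooks in $X$ are denoted $\mathcal{H}^{BGO}(X)$ and $\mathcal{H}^{CJ}(X)$. The map $f$ is defined as follows. On $\mathcal{H}^{CJ}(X)\cap\mathcal{H}^{BGO}(X)$ it is the identity. A CJ-hook which is not a BGO-hook has the form $(a,a+h,i,j)$ with either $i<j$ and $h\ge 0$, or $i>j$ and $h>0$. Fix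 such $i,j,h$, and let $a_1<\cdots<a_r$ be all the elements of $X_i$ with $(a_k,a_k+h,i,j)\in\mathcal{H}^{CJ}(X)$. Recursively for $k=1,\ldots,r$, let $c_k$ be the largest element $c$ of $\{\gamma\in\Gamma_i\mid \gamma<a_k\}\setminus\{c_1,\ldots,c_{k-1}\}$ such that $c+h\in X_j$ (such an element exists), and set $f(a_k,a_k+h,i,j):=(c_k+h,c_k,j,i)$. The map $f$ is injective, and if $f(a,b,i,j)=(a',b',i',j')$ then $|a-b|=a'-b'$ and $\{i,j\}=\{i',j'\}$. *)

(* Defs.v *)
From mathcomp Require Import all_boot.
From mathcomp Require Import classical_sets functions.

Set Implicit Arguments.
Unset Strict Implicit.
Unset Printing Implicit Defensive.

Local Open Scope nat_scope.

Record beta_set := BetaSet {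
  beta_seq :> seq nat;
  beta_seq_sorted : sorted ltn beta_seq
}.

Definition charge (B : beta_set) : nat := size B.

(* The components are indexed by 'I_l, i.e. 0, ..., l - 1 instead of
   1, ..., l; only the order of the indices matters. *)
Definition symbol (l : nat) := l.-tuple beta_set.

Definition multicharge l (X : symbol l) : l.-tuple nat := map_tuple charge X.

Section Symbol.
Variables (l : nat) (X : symbol l).

Definition entries (i : 'I_l) : seq nat := tnth X i.

Definition Gamma (i : 'I_l) : pred nat := [pred n | n \notin entries i].

Definition nb_gaps_below (i : 'I_l) (a : nat) : nat :=
  #|[set g : 'I_a | Gamma i g]|.

Definition quad : Type := (nat * nat * 'I_l * 'I_l)%type.

Definition is_hook (x : quad) : bool :=
  let: (a, b, i, j) := x in (a \in entries i) && Gamma j b.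

Definition is_BGO_hook (x : quad) : bool :=
  let: (a, b, i, j) := x in
  [&& is_hook x, b <= a & (a == b) ==> (j < i)].

Definition is_CJ_hook (x : quad) : bool :=
  let: (a, b, i, j) := x in
  is_hook x && (nb_gaps_below j b < nb_gaps_below i a).

Definition BGO_hooks : set quad := [set x | is_BGO_hook x]%classic.
Definition CJ_hooks : set quad := [set x | is_CJ_hook x]%classic.

Section Pairing.
Variables (i j : 'I_l) (h : nat).

(* a_1 < ... < a_r *)
Definition CJ_starts : seq nat :=
  [seq a <- entries i | is_CJ_hook (a, a + h, i, j)].

(* The largest gap c < a of X_i not in cs with c + h in X_j. The maximum
   defaults to 0 if there is no such c, which does not happen when a = a_k
   and cs = [:: c_1; ...; c_(k-1)]. *)
Definition next_match (cs : seq nat) (a : nat) : nat :=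
  \max_(c < a | [&& Gamma i c, (c : nat) \notin cs & c + h \in entries j]) c.

(* [:: c_1; ...; c_r] *)
Definition matches : seq nat :=
  foldl (fun cs a => rcons cs (next_match cs a)) [::] CJ_starts.

Definition match_of (a : nat) : nat := nth 0 matches (index a CJ_starts).

End Pairing.

(* Only the values on CJ_hooks are meaningful. A CJ-hook (a, b, i, j) that is
   not a BGO-hook satisfies a <= b, so that b = a + (b - a). *)
Definition hook_map (x : quad) : quad :=
  let: (a, b, i, j) := x in
  if is_BGO_hook x then x
  else let h := b - a in
       let c := match_of i j h a in
       (c + h, c, j, i).

End Symbol.

(* Main.v *)
Require Import Defs.
From mathcomp Require Import all_boot zify.
From mathcomp Require Import classical_sets functions.

(** Fix components i and j and a shift h, and read the pairs (n, n + h) for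
    n = 0, 1, 2, ... as a lattice path of height
      d(n) = nb_gaps_below i n - nb_gaps_below j (n + h).
    The path goes up at n exactly when (n + h, n, j, i) is a hook, and goes
    down at n exactly when (n, n + h, i, j) is a hook. The CJ-hooks
    (n, n + h, i, j) are the down-steps that leave a positive height, while
    the hooks (n + h, n, j, i) that are not CJ-hooks are the up-steps that
    leave a nonnegative height. When h > 0, or h = 0 and i < j, these are the
    two kinds of steps that f has to pair, the latter being BGO-hooks.

    Above level 0, each up-step before n either is compensated by a down-step
    before n or contributes to max(d(n), 0); this is [count_upsteps]. The path
    starts at d(0) <= 0, and when the charges are equal it ends at -h <= 0
    ([nb_gaps_below_eventually]), so there are as many up-steps as down-steps
    above level 0. It remains to see that the greedy rule defining f is a
    matching of brackets: it never runs out of candidates, and it never picks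
    an up-step below level 0 ([greedy_correct]). Its values are then distinct
    and as numerous as the up-steps above level 0, so they exhaust them
    ([mem_matches]). In this way f reaches every BGO-hook that is not a
    CJ-hook, and it fixes those that are. *)

Set Implicit Arguments.
Unset Strict Implicit.
Unset Printing Implicit Defensive.

Local Open Scope nat_scope.

(** * Counting in initial segments of the integers *)

Lemma count_iotaS (P : pred nat) n :
  count P (iota 0 n.+1) = count P (iota 0 n) + P n.
Proof. by rewrite -addn1 iotaD count_cat /= addn0. Qed.

Lemma count_mem_iota (s : seq nat) n :
  uniq s -> count (mem s) (iota 0 n) = count (ltn^~ n) s.
Proof.
move=> us; rewrite -!size_filter; apply: perm_size.
apply: uniq_perm; rewrite ?filter_uniq ?iota_uniq // => x.
by rewrite !mem_filter mem_iota /= add0n andbC.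
Qed.

(** * Greedy matching *)

Section Greedy.
Variable P : pred nat.

Definition greedy_next (cs : seq nat) (a : nat) : nat :=
  \max_(c < a | P c && ((c : nat) \notin cs)) c.

Definition greedy (s : seq nat) : seq nat :=
  foldl (fun cs a => rcons cs (greedy_next cs a)) [::] s.

Lemma greedy_rcons s a :
  greedy (rcons s a) = rcons (greedy s) (greedy_next (greedy s) a).
Proof. exact: foldl_rcons. Qed.

Lemma greedy_nextP cs a c0 : c0 < a -> P c0 -> c0 \notin cs ->
  let c := greedy_next cs a in
  [/\ c < a, P c, c \notin cs &
      forall c', c' < a -> P c' -> c' \notin cs -> c' <= c].
Proof.
move=> lt0 P0 n0.
pose A := [pred c : 'I_a | P c && ((c : nat) \notin cs)].
have A0 : 0 < #|A| by apply/card_gt0P; exists (Ordinal lt0); rewrite inE /= P0.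
have [c Ac Ec] := eq_bigmax_cond (fun c : 'I_a => c : nat) A0.
have -> : greedy_next cs a = c by rewrite -Ec.
move: Ac; rewrite inE => /andP[Pc nc]; split=> // c' lt' P' n'.
rewrite -Ec; apply: (leq_bigmax_cond (Ordinal lt')).
by rewrite inE /= P'.
Qed.

(** The hypotheses say in terms of counts that at least one good candidate
    below each a in s is left over by the members of s before a, and that no
    good candidate is left over at a bad one. So beyond a bad candidate every
    member of s still to be treated has a good candidate closer to it, which
    the greedy rule prefers. The last conclusion is a consequence of each
    match being smaller than its partner; it is what the induction needs. *)
Lemma greedy_correct (G : pred nat) s :
    sorted ltn s -> subpred G P ->
    {in s, forall a, count (ltn^~ a) s < count G (iota 0 a)} ->
    {in s, forall a c, c < a -> P c -> ~~ G c ->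
      count G (iota 0 c) <= count (ltn^~ c) s} ->
  [/\ uniq (greedy s), size (greedy s) = size s, all G (greedy s) &
      forall x, count (ltn^~ x) s <= count (ltn^~ x) (greedy s)].
Proof.
move=> + GP; elim/last_ind: s => [|s a IHs]; first by split.
rewrite (sorted_pairwise ltn_trans) -cats1 pairwise_cat /= andbT => /andP[].
rewrite allrel1r -(sorted_pairwise ltn_trans) => /allP s_lt_a ss enough bad.
have countE x : count (ltn^~ x) (s ++ [:: a]) = count (ltn^~ x) s + (a < x).
  by rewrite count_cat /= addn0.
have [||us size_s Gs below_s] := IHs ss.
- move=> b bs; have := enough b; rewrite mem_cat bs => /(_ isT).
  by rewrite countE [a < b]ltnNge (ltnW (s_lt_a b bs)) addn0.
- move=> b bs c lt_cb Pc nGc; have lt_ba := s_lt_a b bs.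
  have := bad b; rewrite mem_cat bs => /(_ isT c lt_cb Pc nGc).
  by rewrite countE [a < c]ltnNge (ltnW (ltn_trans lt_cb lt_ba)) addn0.
rewrite cats1 greedy_rcons; set ms := greedy s in us size_s Gs below_s *.
have in_a : a \in s ++ [:: a] by rewrite mem_cat inE eqxx orbT.
have enough_a : size ms < count G (iota 0 a).
  rewrite size_s; apply: leq_ltn_trans (enough a in_a).
  rewrite countE ltnn addn0 leq_eqVlt; apply/orP; left.
  by rewrite eq_sym -all_count; apply/allP.
(* More good candidates below a than matches used: one is still available. *)
have [c0 c0a /andP[Gc0 nc0]] :
    exists2 c, c < a & G c && (c \notin ms).
  have /allPn[c] : ~~ all (mem ms) (filter G (iota 0 a)).
    apply/negP => /allP sub; move: enough_a; rewrite ltnNge -size_filter.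
    by rewrite uniq_leq_size ?filter_uniq ?iota_uniq.
  rewrite mem_filter mem_iota add0n => /andP[Gc ca] nc.
  by exists c => //; apply/andP.
have [] := greedy_nextP c0a (GP _ Gc0) nc0.
set c := greedy_next ms a => lt_ca Pc nc max_c.
have Gc : G c.
  apply/negPn/negP => nGc.
  (* All good candidates from c to a are used, and at least as many matches
     lie below c as there are good candidates there. *)
  have le_c : count G (iota 0 c) <= count (ltn^~ c) s.
    have := bad a in_a c lt_ca Pc nGc.
    by rewrite countE [a < c]ltnNge (ltnW lt_ca) addn0.
  have le_ca : count G (iota c (a - c)) <= count (predC (ltn^~ c)) ms.
    rewrite -!size_filter; apply: uniq_leq_size.
      by rewrite filter_uniq ?iota_uniq.
    move=> x; rewrite !mem_filter mem_iota /= => /andP[Gx /andP[cx xa]].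
    rewrite -leqNgt cx /=; apply/negPn/negP => nx.
    have := max_c x _ (GP _ Gx) nx; have /eqP : x != c.
      by apply: contraNneq nGc => <-.
    lia.
  have := count_predC (ltn^~ c) ms; have := below_s c.
  have : count G (iota 0 a) = count G (iota 0 c) + count G (iota c (a - c)).
    by rewrite -count_cat -[X in iota X (a - c)]add0n -iotaD subnKC // ltnW.
  lia.
split.
- by rewrite rcons_uniq nc.
- by rewrite !size_rcons size_s.
- by rewrite all_rcons Gc.
move=> x; rewrite -!cats1 !count_cat /= !addn0; apply: leq_add; first exact: below_s.
by case: (ltnP a x) => // ax; rewrite (ltn_trans lt_ca ax).
Qed.

End Greedy.

(** * The lattice path of a pair of components *)

Section Path.
Variables (l : nat) (X : symbol l).

Lemma entries_sorted i : sorted ltn (entries X i).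
Proof. exact: beta_seq_sorted. Qed.

Lemma entries_uniq i : uniq (entries X i).
Proof. exact: sorted_uniq ltn_trans ltnn _ (entries_sorted i). Qed.

Lemma nb_gaps_belowE i n : nb_gaps_below X i n = count (Gamma X i) (iota 0 n).
Proof.
rewrite /nb_gaps_below cardsE cardE size_filter -val_enum_ord count_map.
by rewrite enumT; apply: eq_count => g; rewrite inE.
Qed.

Lemma nb_gaps_below0 i : nb_gaps_below X i 0 = 0.
Proof. by rewrite nb_gaps_belowE. Qed.

Lemma nb_gaps_belowS i n :
  nb_gaps_below X i n.+1 = nb_gaps_below X i n + Gamma X i n.
Proof. by rewrite !nb_gaps_belowE count_iotaS. Qed.

Lemma nb_gaps_below_complement i n :
  count (ltn^~ n) (entries X i) + nb_gaps_below X i n = n.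
Proof.
rewrite nb_gaps_belowE -(count_mem_iota n (entries_uniq i)).
by rewrite -[RHS](size_iota 0) -(count_predC (mem (entries X i))).
Qed.

(** Past the last entry of X_i, the height of the path is
    (n - m_i) - (n + h - m_j) at most. *)
Lemma nb_gaps_below_eventually i j h :
    charge (tnth X i) = charge (tnth X j) ->
  exists N, forall n, N <= n ->
    nb_gaps_below X i n <= nb_gaps_below X j (n + h).
Proof.
move=> eq_charge; have eq_size : size (entries X i) = size (entries X j) by [].
exists (\max_(a <- entries X i) a).+1 => n le_n.
have all_lt : count (ltn^~ n) (entries X i) = size (entries X i).
  apply/eqP; rewrite -all_count; apply/allP => a ain.
  by apply: leq_trans le_n; rewrite ltnS; apply: (@leq_bigmax_seq _ _ xpredT id).
have := nb_gaps_below_complement i n.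
have := nb_gaps_below_complement j (n + h).
have := count_size (ltn^~ (n + h)) (entries X j).
lia.
Qed.

Section Shift.
Variables (i j : 'I_l) (h : nat).

(** The up-steps of the path that leave a nonnegative height. *)
Definition high_upstep : pred nat :=
  [pred c | is_hook X (c + h, c, j, i) && ~~ is_CJ_hook X (c + h, c, j, i)].

Lemma mem_CJ_starts a :
  (a \in CJ_starts X i j h) = is_CJ_hook X (a, a + h, i, j).
Proof. by rewrite mem_filter /= andb_idr // => /andP[/andP[]]. Qed.

Lemma CJ_starts_sorted : sorted ltn (CJ_starts X i j h).
Proof. exact: sorted_filter ltn_trans _ _ (entries_sorted i). Qed.

Lemma CJ_starts_uniq : uniq (CJ_starts X i j h).
Proof. exact: filter_uniq (entries_uniq i). Qed.

(** The truncated difference is the positive part of the height. It is zero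
    at n = 0, it grows precisely at the high up-steps and shrinks precisely
    at the CJ-hooks. *)
Lemma count_upsteps n :
  count high_upstep (iota 0 n) = count (ltn^~ n) (CJ_starts X i j h)
    + (nb_gaps_below X i n - nb_gaps_below X j (n + h)).
Proof.
rewrite -count_mem_iota ?CJ_starts_uniq //.
elim: n => [|n IHn]; first by rewrite nb_gaps_below0.
rewrite !count_iotaS IHn addSn !nb_gaps_belowS.
rewrite -[mem _ n]/(n \in CJ_starts X i j h) mem_CJ_starts /high_upstep /= /Gamma /=.
by case: (n \in _); case: (n + h \in _) => /=; lia.
Qed.

Lemma matches_greedy :
  matches X i j h
  = greedy [pred c | is_hook X (c + h, c, j, i)] (CJ_starts X i j h).
Proof.
rewrite /matches /greedy; elim: (CJ_starts X i j h) [::] => //= a s IHs cs.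
rewrite IHs; congr (foldl _ (rcons _ _) _); apply: eq_bigl => c /=.
by rewrite andbC -andbA andbC.
Qed.

Lemma matches_correct :
  [/\ uniq (matches X i j h),
      size (matches X i j h) = size (CJ_starts X i j h) &
      all high_upstep (matches X i j h)].
Proof.
have [|||um size_m high_m _] := @greedy_correct
  [pred c | is_hook X (c + h, c, j, i)] high_upstep _ CJ_starts_sorted.
- by move=> c /andP[].
- move=> a; rewrite mem_CJ_starts => /andP[_ pos_a].
  by rewrite count_upsteps -[X in X < _]addn0 ltn_add2l subn_gt0.
- move=> a _ c _ hook_c; rewrite /high_upstep /= -/(is_hook X (c + h, c, j, i)).
  move: hook_c => /= -> /=; rewrite negbK => neg_c.
  by rewrite count_upsteps (eqP (ltnW neg_c)) addn0.
- by rewrite matches_greedy.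
Qed.

(** At a place n beyond the last entries, where the height is nonpositive,
    there are as many high up-steps as CJ-hooks before n, hence as many as
    matches. *)
Lemma mem_matches : charge (tnth X i) = charge (tnth X j) ->
  matches X i j h =i high_upstep.
Proof.
move=> eq_charge c; have [um size_m all_m] := matches_correct.
have [N NP] := nb_gaps_below_eventually h eq_charge.
pose n := maxn (maxn N c.+1) (\max_(x <- matches X i j h) x).+1.
have le_N : N <= n by rewrite /n; lia.
have lt_c : c < n by rewrite /n; lia.
have lt_m x : x \in matches X i j h -> x < n.
  move=> xm; rewrite /n leq_max ltnS orbC.
  by rewrite (@leq_bigmax_seq _ _ xpredT id).
have sub : {subset matches X i j h <= filter high_upstep (iota 0 n)}.
  move=> x xm; rewrite mem_filter mem_iota add0n /= lt_m // andbT.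
  exact: (allP all_m).
have [|_ ->] := uniq_min_size um sub.
  rewrite size_filter count_upsteps (eqP (NP n le_N)) addn0 size_m.
  exact: count_size.
by rewrite mem_filter mem_iota add0n lt_c; apply: andbT.
Qed.

Lemma mem_match_of a :
  a \in CJ_starts X i j h -> match_of X i j h a \in matches X i j h.
Proof.
have [_ size_m _] := matches_correct => aS.
by rewrite mem_nth // size_m index_mem.
Qed.

Lemma match_of_inj :
  {in CJ_starts X i j h &, injective (match_of X i j h)}.
Proof.
have [um size_m _] := matches_correct => a b aS bS /eqP.
rewrite nth_uniq ?size_m ?index_mem // => /eqP eq_index.
by rewrite -(nth_index 0 aS) eq_index nth_index.
Qed.

Lemma match_of_surj c : c \in matches X i j h ->
  exists2 a, a \in CJ_starts X i j h & match_of X i j h a = c.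
Proof.
have [um size_m _] := matches_correct => cM.
have lt_c : index c (matches X i j h) < size (CJ_starts X i j h).
  by rewrite -size_m index_mem.
exists (nth 0 (CJ_starts X i j h) (index c (matches X i j h))).
  exact: mem_nth.
by rewrite /match_of index_uniq ?CJ_starts_uniq // nth_index.
Qed.

End Shift.

(** * The hook map *)

Variant hook_map_spec (x : quad l) : quad l -> Prop :=
| HookMapId of is_BGO_hook X x : hook_map_spec x x
| HookMapMatch a h i j of x = (a, a + h, i, j) & ~~ is_BGO_hook X x
    & a \in CJ_starts X i j h & (h == 0) ==> (i < j) :
    hook_map_spec x (match_of X i j h a + h, match_of X i j h a, j, i).

(** A CJ-hook with i = j is a BGO-hook, so a CJ-hook (a, a, i, j) that is not
    a BGO-hook has i < j. *)
Lemma hook_mapP x : is_CJ_hook X x -> hook_map_spec x (hook_map X x).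
Proof.
case: x => [[[a b] i] j] CJx.
rewrite /hook_map; case: ifPn => [|nB]; first exact: HookMapId.
have /andP[hook_x pos_x] := CJx.
have := nB; rewrite /is_BGO_hook hook_x /= negb_and -ltnNge negb_imply => dir.
have le_ab : a <= b by case/orP: dir => [/ltnW //|/andP[/eqP->]].
apply: HookMapMatch => //; first by rewrite subnKC.
  by rewrite mem_CJ_starts subnKC.
apply/implyP => /eqP ab; have eq_ab : a = b by lia.
move: dir; rewrite eq_ab ltnn eqxx /= -leqNgt leq_eqVlt => /orP[|//].
by move=> /eqP/val_inj ij; move: pos_x; rewrite eq_ab ij ltnn.
Qed.

End Path.

Theorem corollary2p1p8 (l : nat) (hl : 0 < l) (X : symbol l)
  (hX : forall i j : 'I_l,
    tnth (multicharge X) i = tnth (multicharge X) j) :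
  set_bij (CJ_hooks X) (BGO_hooks X) (hook_map X).
Proof.
have eq_charge i j : charge (tnth X i) = charge (tnth X j).
  by have := hX i j; rewrite !tnth_map.
have match_high i j h a : a \in CJ_starts X i j h ->
    high_upstep X i j h (match_of X i j h a).
  by move=> /mem_match_of; rewrite mem_matches.
split.
- move=> x /hook_mapP[//|a h i j _ _ /match_high/andP[hook_c _] ij].
  rewrite /BGO_hooks /mkset /is_BGO_hook hook_c leq_addr /=.
  by rewrite -[X in _ == X]addn0 eqn_add2l.
- (* At a CJ-hook that is not a BGO-hook, the value of f is not a CJ-hook, so
     it differs from all hooks that f fixes. *)
  move=> x y; rewrite !inE /CJ_hooks /mkset => CJx CJy; move: (CJx) (CJy).
  case/hook_mapP => [Bx|a h i j -> _ aS _];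
    case/hook_mapP => [By|a' h' i' j' -> _ aS' _] //.
  + move=> Ex; move: CJx; rewrite Ex.
    by case/match_high/andP: aS' => _ /negPf->.
  + move=> Ey; move: CJy; rewrite -Ey.
    by case/match_high/andP: aS => _ /negPf->.
  + case=> Ea Eb Ej Ei; move: Ea; rewrite Eb => /addnI Eh.
    subst i' j' h'; by rewrite (match_of_inj aS aS' Eb).
- move=> [[[a b] j] i]; rewrite /BGO_hooks /mkset => By.
  have [CJy|nCJy] := boolP (is_CJ_hook X (a, b, j, i)).
    by exists (a, b, j, i) => //; rewrite /hook_map By.
  have /and3P[hook_y le_ba dir] := By.
  have Ea : b + (a - b) = a by rewrite subnKC.
  have bM : b \in matches X i j (a - b).
    by rewrite mem_matches // inE Ea hook_y.
  have [c cS cb] := match_of_surj bM.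
  exists (c, c + (a - b), i, j).
    by rewrite /CJ_hooks /mkset -mem_CJ_starts.
  rewrite /hook_map ifN ?addKn ?cb ?Ea //.
  rewrite /is_BGO_hook; apply/negP => /and3P[_ le_c dir'].
  have ab : a = b by lia.
  move: dir dir'; rewrite ab subnn addn0 !eqxx /= => /ltnW.
  by rewrite leqNgt => /negPf->.
Qed.
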